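(* Let $\mathbb{F}=\mathbb{R}$ or $\mathbb{F}=\mathbb{C}$. If $T\in S^d(\mathbb{F}^2)$ is symmetric, then the optimal completely orthogonal rank-$2$ approximation of $T$ can be chosen symmetric, i.e. $$\max_Y\{|\langle T,Y\rangle| : Y\in\mathcal{CON}_2,\ \|Y\|\le 1\}=\max_{v,w,\sigma_1,\sigma_2}\{|\langle T,\sigma_1v^{\otimes d}+\sigma_2w^{\otimes d}\rangle| : v\perp w,\ \|v\|=\|w\|=1,\ |\sigma_1|^2+|\sigma_2|^2=1\},$$ where $v,w\in\mathbb{F}^2$ and $\sigma_1,\sigma_2\in\mathbb{F}$.
   Context: Tensors in $\mathbb{F}^{n_1\times\cdots\times n_d}$ carry the inner product $\langle T,S\rangle=\sum_{i_1,\dots,i_d}T(i_1,\dots,i_d)\overline{S(i_1,\dots,i_d)}$ and norm $\|T\|=\sqrt{\langle T,T\rangle}$. The tensor $v_1\otimes\cdots\otimes v_d$ has entries $\prod_j v_j(i_j)$, and $v^{\otimes d}$ is the $d$-fold tensor power. $S^d(\mathbb{F}^n)$ denotes the tensors in $\mathbb{F}^{n\times\cdots\times n}$ ($d$ factors) invariant under all permutations of the $d$ indices. Two tensors $x_1\otimes\cdots\otimes x_d$ and $y_1\otimes\cdots\otimes y_d$ are completely orthogonal if $\langle x_j,y_j\rangle=0$ for every $j$. $\mathcal{CON}_r$ is the set of all tensors of the form $\sum_{k=1}^r\sigma_k\,v_{k1}\otimes\cdots\otimes v_{kd}$ with $\sigma_k\in\mathbb{F}$ (zero coefficients or zero vectors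 allowed, so that the rank is at most $r$) whose terms are pairwise completely orthogonal. Minimizing $\|T-Y\|$ over $Y\in\mathcal{CON}_r$ is equivalent to maximizing $|\langle T,Y\rangle|$ over $Y\in\mathcal{CON}_r$ with $\|Y\|\le1$, up to rescaling. *)

(* Defs.v *)
From HB Require Import structures.
From mathcomp Require Import all_boot all_order all_algebra all_fingroup.
From mathcomp Require Import boolp classical_sets reals.
From mathcomp Require Import complex.

Set Implicit Arguments.
Unset Strict Implicit.
Unset Printing Implicit Defensive.

Import Order.TTheory GRing.Theory Num.Theory.

Local Open Scope classical_set_scope.
Local Open Scope ring_scope.

Inductive field_kind := RealField | ComplexField.

Definition sfield (R : realType) (K : field_kind) : numFieldType :=
  match K with RealField => R | ComplexField => R[i]%C end.

Definition sconj (R : realType) (K : field_kind) :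
    sfield R K -> sfield R K :=
  match K with RealField => fun x => x | ComplexField => fun z => (z : R[i]%C)^* end.

Definition sRe (R : realType) (K : field_kind) : sfield R K -> R :=
  match K with RealField => fun x => x | ComplexField => fun z => complex.Re z end.

Section Tensors.
Variables (R : realType) (K : field_kind).
Local Notation F := (sfield R K).

(* The norm of a numFieldType takes its values in F; this is its real value. *)
Definition modulus (x : F) : R := sRe `|x|.

Definition vdot n (u v : 'cV[F]_n) : F := \sum_i u i 0 * sconj (v i 0).
Definition vnorm n (v : 'cV[F]_n) : R := Num.sqrt (sRe (vdot v v)).

(* An element of F^(n x ... x n), d factors; the codomain is the regular
   module F^o so that tensors form an F-module. *)
Definition tensor n d := {ffun {ffun 'I_d -> 'I_n} -> F^o}.

Definition tdot n d (T S : tensor n d) : F :=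
  \sum_i (T i : F) * sconj (S i : F).
Definition tnorm n d (T : tensor n d) : R := Num.sqrt (sRe (tdot T T)).

Definition tprod n d (v : 'I_d -> 'cV[F]_n) : tensor n d :=
  [ffun i : {ffun 'I_d -> 'I_n} => \prod_j v j (i j) 0].
Definition tpow n d (v : 'cV[F]_n) : tensor n d := tprod (fun _ : 'I_d => v).

Definition symmetric_tensor n d (T : tensor n d) : Prop :=
  forall (s : {perm 'I_d}) (i : {ffun 'I_d -> 'I_n}),
    T [ffun j => i (s j)] = T i.

Definition completely_orthogonal n d (x y : 'I_d -> 'cV[F]_n) : Prop :=
  forall j, vdot (x j) (y j) = 0.

Definition CON n d (r : nat) : set (tensor n d) :=
  [set Y | exists (sigma : 'I_r -> F) (v : 'I_r -> 'I_d -> 'cV[F]_n),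
     (forall k l, k != l -> completely_orthogonal (v k) (v l)) /\
     Y = \sum_k sigma k *: tprod (v k)].

Definition best_approximation n d (A : set (tensor n d)) (T Y : tensor n d) :
    Prop :=
  A Y /\ forall Z, A Z -> tnorm (T - Y) <= tnorm (T - Z).

End Tensors.

Arguments CON {R K n d} r.
Arguments tpow {R K n} d v.

Definition is_max (R : realType) (A : set R) (m : R) : Prop :=
  A m /\ ubound A m.

(* Main.v *)
(* For unit vectors x_j in F^2 let perp x_j be the orthogonal unit vector
   (unique up to a phase).  The best value of |<T, Y>|^2 over unit tensors Y
   spanned by the x_j- and the perp x_j-product is the energy
     f(x) = |<T, (x) x_j>|^2 + |<T, (x) perp x_j>|^2,
   and both summands are squared moduli of symmetric real-multilinear forms, so
   it suffices to maximise f at a constant tuple, as in Banach's theorem on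
   symmetric forms.  If x_a, x_b are not parallel, then up to a phase
   x_a = r m + s k and x_b = r m - s k with m, k orthonormal and
   r^2 + s^2 = 1, so by polarisation and convexity
     f(x) <= r^2 f(.. m .. m ..) + s^2 f(.. k .. k ..),
   while the squared Frobenius norm of sum_j x_j x_j^* is strictly smaller at x
   than the same mean of its values.  Hence a maximiser of f that maximises this
   norm among all maximisers (both exist by compactness) has parallel entries. *)
Require Import Defs.
From HB Require Import structures.
From mathcomp Require Import all_boot all_order all_algebra all_fingroup.
From mathcomp Require Import boolp classical_sets reals.
From mathcomp Require Import complex.
From mathcomp Require Import topology normedtype derive.
From mathcomp Require Import ring lra.

Set Implicit Arguments.
Unset Strict Implicit.
Unset Printing Implicit Defensive.

Import Order.TTheory GRing.Theory Num.Theory.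
Import numFieldNormedType.Exports.

Local Open Scope classical_set_scope.
Local Open Scope ring_scope.

(** * Scalars *)

Section Scalars.
Variables (R : realType) (K : field_kind).
Local Notation F := (sfield R K).
Implicit Types x y z : F.

Definition sIm : F -> R :=
  match K return sfield R K -> R with
  | RealField => fun=> 0
  | ComplexField => fun c => complex.Im (c : R[i]%C)
  end.

(* For the real field the second argument is ignored. *)
Definition scplx (a b : R) : F :=
  match K return sfield R K with
  | RealField => a
  | ComplexField => Complex a b
  end.

Definition sreal (a : R) : F := scplx a 0.

Definition sqmod x : R := sRe x ^+ 2 + sIm x ^+ 2.

Lemma scalar_ext x y : sRe x = sRe y -> sIm x = sIm y -> x = y.
Proof.
by rewrite /sIm; case: K x y => //= - [a b] [c d] /= -> ->.
Qed.

Lemma scplxE x : scplx (sRe x) (sIm x) = x.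
Proof. by rewrite /scplx /sIm; case: K x => //= - []. Qed.

Lemma sRe_scplx a b : sRe (scplx a b) = a.
Proof. by rewrite /scplx; case: K. Qed.

Lemma sRe_real a : sRe (sreal a) = a. Proof. exact: sRe_scplx. Qed.

Lemma sIm_real a : sIm (sreal a) = 0.
Proof. by rewrite /sIm /sreal /scplx; case: K. Qed.

Lemma sRe0 : sRe (0 : F) = 0. Proof. by case: K. Qed.
Lemma sIm0 : sIm 0 = 0. Proof. by rewrite /sIm; case: K. Qed.
Lemma sRe1 : sRe (1 : F) = 1. Proof. by case: K. Qed.
Lemma sIm1 : sIm 1 = 0. Proof. by rewrite /sIm; case: K. Qed.

Lemma sReD x y : sRe (x + y) = sRe x + sRe y.
Proof. by case: K x y => //= - [a b] [c d]. Qed.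

Lemma sImD x y : sIm (x + y) = sIm x + sIm y.
Proof. by rewrite /sIm; case: K x y => /= [_ _|[a b] [c d]//]; rewrite addr0. Qed.

Lemma sReN x : sRe (- x) = - sRe x.
Proof. by case: K x => //= - [a b]. Qed.

Lemma sImN x : sIm (- x) = - sIm x.
Proof. by rewrite /sIm; case: K x => /= [_|[a b]//]; rewrite oppr0. Qed.

Lemma sReM x y : sRe (x * y) = sRe x * sRe y - sIm x * sIm y.
Proof.
by rewrite /sIm; case: K x y => /= [x y|[a b] [c d]//]; rewrite mul0r subr0.
Qed.

Lemma sImM x y : sIm (x * y) = sRe x * sIm y + sIm x * sRe y.
Proof.
rewrite /sIm; case: K x y => /= [x y|[a b] [c d]//].
by rewrite mulr0 mul0r addr0.
Qed.

Lemma sRe_conj x : sRe (sconj x) = sRe x.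
Proof. by case: K x => //= - []. Qed.

Lemma sIm_conj x : sIm (sconj x) = - sIm x.
Proof. by rewrite /sIm; case: K x => /= [_|[]//]; rewrite oppr0. Qed.

(** Together with [scalar_ext] this turns an identity in F into polynomial identities over R, so
    that [ring] settles the real and the complex case at once. *)
Definition sE := (sReD, sImD, sReN, sImN, sReM, sImM, sRe_conj, sIm_conj,
  sRe_real, sIm_real, sRe0, sIm0, sRe1, sIm1).

Lemma sconj0 : sconj (0 : F) = 0.
Proof. by apply: scalar_ext; rewrite !sE ?oppr0. Qed.

Lemma sconj1 : sconj (1 : F) = 1.
Proof. by apply: scalar_ext; rewrite !sE ?oppr0. Qed.

Lemma sconjD x y : sconj (x + y) = sconj x + sconj y.
Proof. by apply: scalar_ext; rewrite !sE //; ring. Qed.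

Lemma sconjN x : sconj (- x) = - sconj x.
Proof. by apply: scalar_ext; rewrite !sE. Qed.

Lemma sconjM x y : sconj (x * y) = sconj x * sconj y.
Proof. by apply: scalar_ext; rewrite !sE; ring. Qed.

Lemma sconjK : involutive (@sconj R K).
Proof. by move=> x; apply: scalar_ext; rewrite !sE ?opprK. Qed.

Lemma sconj_real a : sconj (sreal a) = sreal a.
Proof. by apply: scalar_ext; rewrite !sE ?oppr0. Qed.

Lemma sconj_sum I (r : seq I) (P : pred I) (f : I -> F) :
  sconj (\sum_(i <- r | P i) f i) = \sum_(i <- r | P i) sconj (f i).
Proof. exact: (big_morph _ sconjD sconj0). Qed.

Lemma sconj_prod I (r : seq I) (P : pred I) (f : I -> F) :
  sconj (\prod_(i <- r | P i) f i) = \prod_(i <- r | P i) sconj (f i).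
Proof. exact: (big_morph _ sconjM sconj1). Qed.

Lemma sreal0 : sreal 0 = 0. Proof. by apply: scalar_ext; rewrite !sE. Qed.
Lemma sreal1 : sreal 1 = 1. Proof. by apply: scalar_ext; rewrite !sE. Qed.

Lemma srealD a b : sreal (a + b) = sreal a + sreal b.
Proof. by apply: scalar_ext; rewrite !sE ?addr0. Qed.

Lemma srealM a b : sreal (a * b) = sreal a * sreal b.
Proof. by apply: scalar_ext; rewrite !sE; ring. Qed.

Lemma sqmod_conjE x : x * sconj x = sreal (sqmod x).
Proof. by apply: scalar_ext; rewrite !sE /sqmod; ring. Qed.

Lemma sqmod_ge0 x : 0 <= sqmod x.
Proof. by rewrite addr_ge0 ?sqr_ge0. Qed.

Lemma sqmodM x y : sqmod (x * y) = sqmod x * sqmod y.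
Proof. by rewrite /sqmod !sE; ring. Qed.

Lemma sqmodN x : sqmod (- x) = sqmod x.
Proof. by rewrite /sqmod !sE; ring. Qed.

Lemma sqmod_conj x : sqmod (sconj x) = sqmod x.
Proof. by rewrite /sqmod !sE; ring. Qed.

Lemma sqmod_real a : sqmod (sreal a) = a ^+ 2.
Proof. by rewrite /sqmod !sE; ring. Qed.

Lemma sqmod0 : sqmod 0 = 0.
Proof. by rewrite -sreal0 sqmod_real expr0n. Qed.

Lemma sqmod1 : sqmod 1 = 1.
Proof. by rewrite -sreal1 sqmod_real expr1n. Qed.

Lemma sqmod_eq0 x : (sqmod x == 0) = (x == 0).
Proof.
apply/eqP/eqP => [|->]; last exact: sqmod0.
move/eqP; rewrite paddr_eq0 ?sqr_ge0 // !sqrf_eq0 => /andP[/eqP re /eqP im].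
by apply: scalar_ext; rewrite !sE.
Qed.

Lemma sqmod_prod I (r : seq I) (P : pred I) (f : I -> F) :
  sqmod (\prod_(i <- r | P i) f i) = \prod_(i <- r | P i) sqmod (f i).
Proof. exact: (big_morph _ sqmodM sqmod1). Qed.

Lemma modulusE x : modulus x = Num.sqrt (sqmod x).
Proof.
rewrite /modulus /sqmod /sIm; case: K x => /= [x|[a b]].
  by rewrite expr0n addr0 sqrtr_sqr.
exact: (congr1 (@complex.Re R) (normc_def (Complex a b))).
Qed.

Lemma modulus_ge0 x : 0 <= modulus x.
Proof. by rewrite modulusE sqrtr_ge0. Qed.

Lemma modulus_sqr x : modulus x ^+ 2 = sqmod x.
Proof. by rewrite modulusE sqr_sqrtr ?sqmod_ge0. Qed.

Lemma sRe_le_modulus x : sRe x <= modulus x.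
Proof.
have [h|/ltW h] := leP 0 (sRe x); last exact: le_trans h (modulus_ge0 _).
rewrite -(@ler_pXn2r _ 2) ?nnegrE ?modulus_ge0 // modulus_sqr lerDl.
exact: sqr_ge0.
Qed.

(** Convexity with its exact defect; the defect term is what makes the inequality of [coherence_mix]
    strict. *)
Lemma sqmod_mix (c : R) x y :
  sqmod (sreal c * x + sreal (1 - c) * y) =
  c * sqmod x + (1 - c) * sqmod y - c * (1 - c) * sqmod (x - y).
Proof. by rewrite /sqmod !sE; ring. Qed.

Lemma sqmod_mix_le (c : R) x y : 0 <= c <= 1 ->
  sqmod (sreal c * x + sreal (1 - c) * y) <= c * sqmod x + (1 - c) * sqmod y.
Proof.
move=> /andP[c0 c1]; rewrite sqmod_mix gerBl !mulr_ge0 ?subr_ge0 //.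
exact: sqmod_ge0.
Qed.

(** Lagrange's identity: the gap between the two sides is itself a squared modulus. *)
Lemma sqmod_cauchy x y x' y' :
  sqmod (x * x' + y * y') <= (sqmod x + sqmod y) * (sqmod x' + sqmod y').
Proof.
rewrite -subr_ge0 [leRHS](_ : _ = sqmod (x * sconj y' - y * sconj x')).
  exact: sqmod_ge0.
by rewrite /sqmod !sE; ring.
Qed.

Lemma phase_exists z :
  exists (w : F) (t : R), [/\ sqmod w = 1, 0 <= t & sconj w * z = sreal t].
Proof.
have [->|z0] := eqVneq z 0.
  by exists 1, 0; rewrite sqmod1 mulr0 sreal0.
have m0 : modulus z != 0.
  by rewrite -sqrf_eq0 modulus_sqr sqmod_eq0.
exists (z * sreal (modulus z)^-1), (modulus z); split.
- by rewrite sqmodM sqmod_real exprVn modulus_sqr divff // sqmod_eq0.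
- exact: modulus_ge0.
- rewrite sconjM sconj_real mulrAC [_ * z]mulrC sqmod_conjE -modulus_sqr.
  by rewrite -srealM expr2 mulfK.
Qed.

End Scalars.

(** * Vectors *)

Section Vectors.
Variables (R : realType) (K : field_kind) (n : nat).
Local Notation F := (sfield R K).
Implicit Types u v m k : 'cV[F]_n.

Definition nsq v : R := \sum_i sqmod (v i 0).

Lemma vdot_nsq v : vdot v v = sreal K (nsq v).
Proof.
rewrite /nsq (big_morph _ (@srealD R K) (@sreal0 R K)).
by apply: eq_bigr => i _; rewrite sqmod_conjE.
Qed.

Lemma nsq_ge0 v : 0 <= nsq v.
Proof. by apply: sumr_ge0 => i _; apply: sqmod_ge0. Qed.

Lemma nsq_eq0 v : (nsq v == 0) = (v == 0).
Proof.
apply/eqP/eqP => [h|->]; last by apply: big1 => i _; rewrite mxE sqmod0.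
apply/colP => i; rewrite mxE; apply/eqP; rewrite -sqmod_eq0; apply/eqP.
by apply: (psumr_eq0P _ h) => // j _; apply: sqmod_ge0.
Qed.

Lemma nsqZ (z : F) v : nsq (z *: v) = sqmod z * nsq v.
Proof. by rewrite /nsq mulr_sumr; apply: eq_bigr => i _; rewrite mxE sqmodM. Qed.

Lemma sqmod_le_nsq v i : sqmod (v i 0) <= nsq v.
Proof.
by rewrite /nsq (bigD1 i) //= lerDl sumr_ge0 // => j _; apply: sqmod_ge0.
Qed.

Lemma vnorm_eq1 v : vnorm v = 1 <-> nsq v = 1.
Proof.
rewrite /vnorm vdot_nsq sRe_real; split=> [h|->]; last exact: sqrtr1.
by rewrite -(sqr_sqrtr (nsq_ge0 v)) h expr1n.
Qed.

Lemma vdotDl u u' v : vdot (u + u') v = vdot u v + vdot u' v.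
Proof. by rewrite /vdot -big_split; apply: eq_bigr => i _; rewrite mxE mulrDl. Qed.

Lemma vdotC u v : vdot u v = sconj (vdot v u).
Proof.
by rewrite /vdot sconj_sum; apply: eq_bigr => i _; rewrite sconjM sconjK mulrC.
Qed.

Lemma vdotDr u v v' : vdot u (v + v') = vdot u v + vdot u v'.
Proof. by rewrite vdotC vdotDl sconjD -!vdotC. Qed.

Lemma vdotZl (z : F) u v : vdot (z *: u) v = z * vdot u v.
Proof. by rewrite /vdot mulr_sumr; apply: eq_bigr => i _; rewrite mxE mulrA. Qed.

Lemma vdotZr (z : F) u v : vdot u (z *: v) = sconj z * vdot u v.
Proof. by rewrite vdotC vdotZl sconjM -vdotC. Qed.

Lemma vdotNr u v : vdot u (- v) = - vdot u v.
Proof. by rewrite -scaleN1r vdotZr sconjN sconj1 mulN1r. Qed.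

Lemma vdotNl u v : vdot (- u) v = - vdot u v.
Proof. by rewrite -scaleN1r vdotZl mulN1r. Qed.

Lemma nsqE v : nsq v = sRe (vdot v v).
Proof. by rewrite vdot_nsq sRe_real. Qed.

(* After a change of phase <u, v> becomes a real t >= 0; then m and k are the
   normalised sum and difference, and a^2 = (1 + t) / 2. *)
Lemma unit_bisection u v : nsq u = 1 -> nsq v = 1 ->
  (exists2 w : F, sqmod w = 1 & v = w *: u) \/
  exists (w : F) (a b : R) m k,
    [/\ sqmod w = 1, [/\ 0 < a, 0 < b & a ^+ 2 + b ^+ 2 = 1],
        [/\ nsq m = 1, nsq k = 1 & vdot m k = 0],
        u = sreal K a *: m + sreal K b *: k
      & w *: v = sreal K a *: m - sreal K b *: k].
Proof.
move=> u1 v1; have [w [t [w1 t0 wt]]] := phase_exists (vdot u v).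
set v' := w *: v.
have v'1 : nsq v' = 1 by rewrite nsqZ w1 v1 mulr1.
have uv' : vdot u v' = sreal K t by rewrite vdotZr.
have v'u : vdot v' u = sreal K t by rewrite vdotC uv' sconj_real.
have uu : vdot u u = 1 by rewrite vdot_nsq u1 sreal1.
have v'v' : vdot v' v' = 1 by rewrite vdot_nsq v'1 sreal1.
have np : nsq (u + v') = 2 + 2 * t.
  by rewrite nsqE !(vdotDl, vdotDr) uu v'v' uv' v'u !sE; ring.
have nm : nsq (u - v') = 2 - 2 * t.
  by rewrite nsqE !(vdotDl, vdotDr, vdotNl, vdotNr) uu v'v' uv' v'u !sE; ring.
(* Equality case of Cauchy-Schwarz: t = 1 makes |u - v'|^2 = 2 - 2t vanish, so v is a phase times
   u. *)
have [t1|t1] := eqVneq t 1.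
  left; exists (sconj w); first by rewrite sqmod_conj.
  have /eqP : nsq (u - v') = 0 by rewrite nm t1 mulr1 subrr.
  rewrite nsq_eq0 subr_eq0 => /eqP ->.
  by rewrite scalerA mulrC sqmod_conjE w1 sreal1 scale1r.
have tlt : t < 1.
  by rewrite lt_neqAle t1 /=; have := nsq_ge0 (u - v'); rewrite nm; lra.
pose a := Num.sqrt ((1 + t) / 2); pose b := Num.sqrt ((1 - t) / 2).
have a0 : 0 < a by rewrite sqrtr_gt0; lra.
have b0 : 0 < b by rewrite sqrtr_gt0; lra.
have a2 : a ^+ 2 = (1 + t) / 2 by rewrite sqr_sqrtr //; lra.
have b2 : b ^+ 2 = (1 - t) / 2 by rewrite sqr_sqrtr //; lra.
have half (c : R) : 0 < c -> sreal K c * sreal K (2 * c)^-1 = sreal K 2^-1.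
  by move=> c0; rewrite -srealM invfM mulrCA divff ?mulr1 // gt_eqF.
have hh : sreal K 2^-1 + sreal K 2^-1 = 1 :> F.
  by rewrite -srealD -sreal1; congr sreal; lra.
(* Since |u + v'|^2 = 4a^2 and |u - v'|^2 = 4b^2, these factors give unit vectors; they are
   orthogonal because <u, v'> is real. *)
right; exists w, a, b, (sreal K (2 * a)^-1 *: (u + v')),
  (sreal K (2 * b)^-1 *: (u - v')).
split=> //.
- by split=> //; rewrite a2 b2; lra.
- split.
  + rewrite nsqZ np sqmod_real exprVn exprMn a2.
    by field; rewrite gt_eqF //; lra.
  + rewrite nsqZ nm sqmod_real exprVn exprMn b2.
    by field; rewrite gt_eqF //; lra.
  + rewrite vdotZl vdotZr !(vdotDl, vdotDr, vdotNl, vdotNr) uu v'v' uv' v'u.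
    by rewrite addrA subrK subrr !mulr0.
- by rewrite !scalerA !half // -scalerDr addrACA addrN addr0 scalerDr -scalerDl
    hh scale1r.
- by rewrite !scalerA !half // -scalerBr opprD opprK addrACA addrN add0r
    scalerDr -scalerDl hh scale1r.
Qed.

End Vectors.

(** * Continuity and compactness *)

Definition update (A : eqType) (B : Type) (x : A -> B) (a : A) (v : B) : A -> B :=
  fun j => if j == a then v else x j.

Section Continuity.
Variables (R : realType) (K : field_kind) (X : topologicalType).
Local Notation F := (sfield R K).

(* R[i] carries no ready-made real topology here, so continuity is stated
   through the real and imaginary parts. *)
Definition scontinuous (h : X -> F) : Prop :=
  continuous (fun p => sRe (h p)) /\ continuous (fun p => sIm (h p)).

Lemma scontinuous_cst (c : F) : scontinuous (fun=> c).
Proof. by split=> p; apply: cvg_cst. Qed.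

Lemma scontinuous_scplx (h k : X -> R) :
  continuous h -> continuous k -> scontinuous (fun p => scplx K (h p) (k p)).
Proof.
rewrite /scontinuous /sIm /scplx; case: K => /= ch ck; split=> //.
by move=> p; apply: cvg_cst.
Qed.

Lemma scontinuousD (h k : X -> F) :
  scontinuous h -> scontinuous k -> scontinuous (fun p => h p + k p).
Proof.
move=> [h1 h2] [k1 k2]; split.
  under eq_fun do rewrite sReD.
  by move=> p; apply: cvgD; [exact: h1 | exact: k1].
under eq_fun do rewrite sImD.
by move=> p; apply: cvgD; [exact: h2 | exact: k2].
Qed.

Lemma scontinuousM (h k : X -> F) :
  scontinuous h -> scontinuous k -> scontinuous (fun p => h p * k p).
Proof.
move=> [h1 h2] [k1 k2]; split.
  under eq_fun do rewrite sReM.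
  by move=> p; apply: cvgB; apply: cvgM; by [apply: h1|apply: h2|apply: k1|apply: k2].
under eq_fun do rewrite sImM.
by move=> p; apply: cvgD; apply: cvgM; by [apply: h1|apply: h2|apply: k1|apply: k2].
Qed.

Lemma scontinuous_conj (h : X -> F) :
  scontinuous h -> scontinuous (fun p => sconj (h p)).
Proof.
move=> [h1 h2]; split.
  by under eq_fun do rewrite sRe_conj.
under eq_fun do rewrite sIm_conj.
by move=> p; apply: cvgN; apply: h2.
Qed.

Lemma scontinuousN (h : X -> F) :
  scontinuous h -> scontinuous (fun p => - h p).
Proof.
move=> hh; under eq_fun do rewrite -mulN1r.
by apply: scontinuousM hh; apply: scontinuous_cst.
Qed.

Lemma scontinuous_sum (I : Type) (r : seq I) (h : I -> X -> F) :
  (forall i, scontinuous (h i)) -> scontinuous (fun p => \sum_(i <- r) h i p).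
Proof.
move=> hh; elim: r => [|i r IH].
  by under eq_fun do rewrite big_nil; apply: scontinuous_cst.
by under eq_fun do rewrite big_cons; apply: scontinuousD.
Qed.

Lemma scontinuous_prod (I : Type) (r : seq I) (h : I -> X -> F) :
  (forall i, scontinuous (h i)) -> scontinuous (fun p => \prod_(i <- r) h i p).
Proof.
move=> hh; elim: r => [|i r IH].
  by under eq_fun do rewrite big_nil; apply: scontinuous_cst.
by under eq_fun do rewrite big_cons; apply: scontinuousM.
Qed.

Lemma continuous_sqmod (h : X -> F) :
  scontinuous h -> continuous (fun p => sqmod (h p)).
Proof.
move=> hh; have [+ _] := scontinuousM hh (scontinuous_conj hh).
by under eq_fun do rewrite sqmod_conjE sRe_real.
Qed.

Lemma continuous_rsum (I : Type) (r : seq I) (h : I -> X -> R) :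
  (forall i, continuous (h i)) -> continuous (fun p => \sum_(i <- r) h i p).
Proof.
move=> hh; elim: r => [|i r IH].
  by under eq_fun do rewrite big_nil; move=> p; apply: cvg_cst.
by under eq_fun do rewrite big_cons; move=> p; apply: cvgD; [apply: hh|apply: IH].
Qed.

(** Two maximisations in a row: the maximisers of f on A form a closed subset of a compact set, and
    g attains its maximum there. *)
Lemma compact_lexmax (A : set X) (f g : X -> R) :
    A !=set0 -> compact A -> continuous f -> continuous g ->
  exists2 x, A x & forall y, A y -> f y <= f x /\ (f y = f x -> g y <= g x).
Proof.
move=> A0 cA cf cg.
have [x /set_mem Ax fx] := compact_EVT_max A0 cA (continuous_subspaceT cf).
pose B := A `&` f @^-1` [set f x].
have clB : closed (f @^-1` [set f x]).
  by apply: preimage_closed => [? _|]; [exact: cf | exact: closed_eq].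
have cB : compact B by apply: compact_closedI.
have B0 : B !=set0 by exists x.
have [z /set_mem [Az /= fz] gz] :=
  compact_EVT_max B0 cB (continuous_subspaceT cg).
exists z => // y Ay; rewrite fz; split; first by apply/fx/mem_set.
by move=> fy; apply/gz/mem_set.
Qed.

End Continuity.

(** * Compactness of the set of unit tuples *)

Section UnitTuples.
Variables (R : realType) (K : field_kind) (n d : nat).
Local Notation F := (sfield R K).
Local Notation vectors := ('I_d -> 'cV[F]_n).

Definition unit_tuple (x : vectors) : Prop := forall j, nsq (x j) = 1.

(** Continuity is tested along coordinatewise continuous families, so no topology on [vectors] has
    to be chosen. *)
Definition tcontinuous (f : vectors -> R) : Prop :=
  forall (X : topologicalType) (h : X -> vectors),
    (forall j i, scontinuous (fun p => h p j i 0)) ->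
    continuous (fun p => f (h p)).

Lemma unit_tuple_lexmax (f g : vectors -> R) :
    (exists x, unit_tuple x) -> tcontinuous f -> tcontinuous g ->
  exists2 x, unit_tuple x &
    forall y, unit_tuple y -> f y <= f x /\ (f y = f x -> g y <= g x).
Proof.
move=> [x0 x0u] cf cg.
pose I : eqType := ('I_d * 'I_n * bool)%type.
pose X : topologicalType := prod_topology (fun _ : I => R : topologicalType).
pose h (p : X) : vectors :=
  fun j => \col_i scplx K (p (j, i, true)) (p (j, i, false)).
have proj_cont (t : I) : continuous (fun p : X => p t).
  exact: (@proj_continuous I (fun=> R : topologicalType) t).
have hc j i : scontinuous (fun p => h p j i 0).
  have -> : (fun p => h p j i 0) =
      (fun p : X => scplx K (p (j, i, true)) (p (j, i, false))).
    by apply/funext => p; rewrite mxE.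
  by apply: scontinuous_scplx; apply: proj_cont.
(* For the real field [h] ignores the coordinates tagged [false], so the preimage of the unit tuples
   can be unbounded; the cube restores compactness. *)
pose cube := [set p : X | forall i, `[-1, 1]%classic (p i)].
have ccube : compact cube.
  exact: (@tychonoff I (fun=> R : topologicalType) (fun=> `[-1, 1]%classic)
    (fun=> @segment_compact R _ _)).
pose U := [set p : X | unit_tuple (h p)].
have clU : closed U.
  rewrite (_ : U = \bigcap_(j in setT) ((fun p => nsq (h p j)) @^-1` [set 1])).
    apply: closed_bigI => j _; apply: preimage_closed; last exact: closed_eq.
    move=> p _; apply: continuous_rsum => i; apply: continuous_sqmod; exact: hc.
  by apply/seteqP; split=> p Hp; [move=> j _; exact: Hp | move=> j; exact: Hp].
have cA : compact (cube `&` U) by exact: compact_closedI.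
(* The cube loses no unit tuple: each real coordinate of a unit vector has square at most 1. *)
have lift x : unit_tuple x -> exists2 p, (cube `&` U) p & h p = x.
  move=> xu; pose p : X := fun t =>
    let: (j, i, b) := t in if b then sRe (x j i 0) else sIm (x j i 0).
  have hp : h p = x by apply/funext => j; apply/colP => i; rewrite mxE scplxE.
  exists p => //; split; last by rewrite /U /= hp.
  move=> [[j i] b]; rewrite /= in_itv /= -ler_norml -(@ler_pXn2r _ 2) // ?nnegrE //.
  rewrite expr1n real_normK ?num_real // -[leRHS](xu j).
  apply: le_trans (sqmod_le_nsq (x j) i).
  by case: b; rewrite /sqmod ?lerDl ?lerDr sqr_ge0.
have A0 : cube `&` U !=set0 by have [p Ap _] := lift _ x0u; exists p.
have [p [_ pU] pmax] := compact_lexmax A0 cA (cf _ _ hc) (cg _ _ hc).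
exists (h p) => // y yu; have [q Aq <-] := lift y yu.
exact: pmax.
Qed.

End UnitTuples.

(** * Banach's theorem for symmetric forms *)

(** The slacks p(z - x) and q(z - y) are nonnegative and their sum is at most 0, so both vanish. *)
Lemma mix_extreme (R : realFieldType) (p q z x y : R) :
    0 < p -> 0 < q -> p + q = 1 -> x <= z -> y <= z -> z <= p * x + q * y ->
  x = z /\ y = z.
Proof.
move=> p0 q0 pq xz yz zxy.
have qE : q = 1 - p by rewrite -pq; ring.
have px : p * (z - x) >= 0 by rewrite mulr_ge0 ?subr_ge0 // ltW.
have qy : q * (z - y) >= 0 by rewrite mulr_ge0 ?subr_ge0 // ltW.
have px0 : p * (z - x) = 0 by subst q; lra.
have qy0 : q * (z - y) = 0 by subst q; lra.
move/eqP: px0; move/eqP: qy0; rewrite !mulf_eq0 (gt_eqF p0) (gt_eqF q0) !subr_eq0.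
by move=> /eqP <- /eqP <-.
Qed.

Section Symmetrization.
Variables (R : realType) (K : field_kind) (n d : nat).
Local Notation F := (sfield R K).
Local Notation vectors := ('I_d -> 'cV[F]_n).
Implicit Types (x y : vectors) (a b j : 'I_d) (u v m k : 'cV[F]_n).

(* Covers both T |-> <T, x_1 (x) ... (x) x_d> and its composition with an
   antilinear map; this is why only real scalars and phases are mentioned. *)
Record symmetric_form (g : vectors -> F) : Prop := SymmetricForm {
  form_perm : forall (s : {perm 'I_d}) x, g (x \o s) = g x;
  formD : forall x a u v,
    g (update x a (u + v)) = g (update x a u) + g (update x a v);
  formZ : forall x a (r : R) u,
    g (update x a (sreal K r *: u)) = sreal K r * g (update x a u);
  form_phase : forall x (w : 'I_d -> F), (forall j, sqmod (w j) = 1) ->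
    sqmod (g (fun j => w j *: x j)) = sqmod (g x);
  form_cont : forall (X : topologicalType) (h : X -> vectors),
    (forall j i, scontinuous (fun p => h p j i 0)) ->
    scontinuous (fun p => g (h p)) }.

Definition update2 x a b u v := update (update x a u) b v.

Lemma update2C x a b u v : a != b -> update2 x a b u v = update2 x b a v u.
Proof.
move=> ab; apply/funext => j; rewrite /update2 /update.
by case: eqVneq => // ->; rewrite eq_sym (negbTE ab).
Qed.

Lemma update2_id x a b : update2 x a b (x a) (x b) = x.
Proof.
by apply/funext => j; rewrite /update2 /update; case: eqVneq => [->|_] //;
  case: eqVneq => [->|].
Qed.

Lemma form_swap g x a b u v : symmetric_form g -> a != b ->
  g (update2 x a b u v) = g (update2 x a b v u).
Proof.
move=> sg ab; rewrite -(form_perm sg (tperm a b)); congr g.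
apply/funext => j; rewrite /= /update2 /update.
case: tpermP => [->|->|/eqP ja /eqP jb].
- by rewrite eqxx (negbTE ab) eqxx.
- by rewrite (negbTE ab) !eqxx.
- by rewrite (negbTE ja) (negbTE jb).
Qed.

(* Polarisation: the mixed terms cancel by symmetry. *)
Lemma form_polar g x a b (r s : R) m k : symmetric_form g -> a != b ->
  g (update2 x a b (sreal K r *: m + sreal K s *: k)
                   (sreal K r *: m - sreal K s *: k)) =
  sreal K (r ^+ 2) * g (update2 x a b m m) -
  sreal K (s ^+ 2) * g (update2 x a b k k).
Proof.
move=> sg ab.
have addl u u' v : g (update2 x a b (u + u') v) =
    g (update2 x a b u v) + g (update2 x a b u' v).
  by rewrite !(@update2C x a b _ _ ab) (formD sg).
have addr u v v' : g (update2 x a b u (v + v')) =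
    g (update2 x a b u v) + g (update2 x a b u v').
  by rewrite (formD sg).
have scalel c u v : g (update2 x a b (sreal K c *: u) v) =
    sreal K c * g (update2 x a b u v).
  by rewrite !(@update2C x a b _ _ ab) (formZ sg).
have scaler c u v : g (update2 x a b u (sreal K c *: v)) =
    sreal K c * g (update2 x a b u v).
  by rewrite (formZ sg).
have sN c u : - (sreal K c *: u) = sreal K (- c) *: u.
  rewrite -scaleNr; congr (_ *: _).
  by apply: scalar_ext; rewrite !sE ?oppr0.
have rN c : sreal K (- c) = - sreal K c.
  by apply: scalar_ext; rewrite !sE ?oppr0.
rewrite sN addl !addr !scalel !scaler (form_swap _ k m sg ab) rN !expr2 !srealM.
ring.
Qed.

(* The sum of the projections onto the lines spanned by the x_j, whose squared
   Frobenius norm [coherence] strictly increases under bisection. *)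
Definition frame_op x (p q : 'I_n) : F := \sum_j x j p 0 * sconj (x j q 0).

Definition coherence x : R := \sum_p \sum_q sqmod (frame_op x p q).

Lemma frame_op_update2 x a b u v p q : a != b ->
  frame_op (update2 x a b u v) p q =
  u p 0 * sconj (u q 0) + (v p 0 * sconj (v q 0) +
    \sum_(j | (j != a) && (j != b)) x j p 0 * sconj (x j q 0)).
Proof.
move=> ab; rewrite /frame_op (bigD1 a) //= (bigD1 b) 1?eq_sym //=.
rewrite /update2 /update !eqxx (negbTE ab); congr (_ + (_ + _)).
by apply: eq_bigr => j /andP[/negbTE -> /negbTE ->].
Qed.

Lemma coherence_phase x (w : 'I_d -> F) : (forall j, sqmod (w j) = 1) ->
  coherence (fun j => w j *: x j) = coherence x.
Proof.
move=> w1; apply: eq_bigr => p _; apply: eq_bigr => q _; congr sqmod.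
apply: eq_bigr => j _; rewrite !mxE sconjM mulrACA sqmod_conjE w1 sreal1.
by rewrite mul1r.
Qed.

Lemma coherence_cont : tcontinuous coherence.
Proof.
move=> X h hc; apply: continuous_rsum => p; apply: continuous_rsum => q.
apply: continuous_sqmod; apply: scontinuous_sum => j.
by apply: scontinuousM; [|apply: scontinuous_conj].
Qed.

Lemma coherence_mix x a b (r s : R) m k : a != b -> 0 < r -> 0 < s ->
    r ^+ 2 + s ^+ 2 = 1 -> nsq m = 1 -> nsq k = 1 -> vdot m k = 0 ->
  coherence (update2 x a b (sreal K r *: m + sreal K s *: k)
                           (sreal K r *: m - sreal K s *: k)) <
  r ^+ 2 * coherence (update2 x a b m m) +
  s ^+ 2 * coherence (update2 x a b k k).
Proof.
move=> ab r0 s0 rs m1 k1 mk.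
set y := update2 x a b _ _; set ym := update2 x a b m m.
set yk := update2 x a b k k.
pose D p q := frame_op ym p q - frame_op yk p q.
have s2 : s ^+ 2 = 1 - r ^+ 2 by rewrite -rs; ring.
have mix p q : sqmod (frame_op y p q) = r ^+ 2 * sqmod (frame_op ym p q) +
    s ^+ 2 * sqmod (frame_op yk p q) - r ^+ 2 * s ^+ 2 * sqmod (D p q).
  rewrite s2 -sqmod_mix -s2; congr sqmod.
  rewrite !frame_op_update2 //; set rest := \sum_(_ | _) _.
  have {1}-> : rest = sreal K (r ^+ 2) * rest + sreal K (s ^+ 2) * rest.
    by rewrite -mulrDl -srealD rs sreal1 mul1r.
  rewrite !mxE !(sconjD, sconjN, sconjM, sconj_real) !expr2 !srealM; ring.
have -> : coherence y = r ^+ 2 * coherence ym + s ^+ 2 * coherence yk -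
    r ^+ 2 * s ^+ 2 * \sum_p \sum_q sqmod (D p q).
  rewrite /coherence !mulr_sumr -sumrN -!big_split; apply: eq_bigr => p _ /=.
  rewrite !mulr_sumr -sumrN -!big_split; apply: eq_bigr => q _ /=; exact: mix.
have Dsum_ge0 p : 0 <= \sum_q sqmod (D p q).
  by apply: sumr_ge0 => q _; apply: sqmod_ge0.
rewrite gtrBl; apply: mulr_gt0; first by rewrite mulr_gt0 ?exprn_gt0.
rewrite lt_neqAle eq_sym sumr_ge0 ?andbT //; apply/eqP => D0.
have {}D0 p q : m p 0 * sconj (m q 0) = k p 0 * sconj (k q 0).
  have /eqP : sqmod (D p q) = 0.
    apply: (psumr_eq0P _ (psumr_eq0P _ D0 _)) => // i _.
    exact: sqmod_ge0.
  rewrite sqmod_eq0 /D !frame_op_update2 // subr_eq0 !addrA => /eqP/addIr.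
  by rewrite -!mulr2n => /eqP; rewrite eqrMn2r //= => /eqP.
(* Apply mm^* = kk^* to m: the left side is m, the right side is a multiple of <m, k> = 0. *)
have m0 : m = 0.
  apply/colP => p; rewrite mxE -[LHS]mulr1 -(sreal1 R K) -m1 -vdot_nsq.
  rewrite /vdot mulr_sumr; transitivity (\sum_i k p 0 * (m i 0 * sconj (k i 0))).
    apply: eq_bigr => q _; rewrite mulrCA D0; ring.
  by rewrite -mulr_sumr -/(vdot m k) mk mulr0.
have /eqP : nsq m = 0 by apply/eqP; rewrite nsq_eq0 m0.
by rewrite m1 oner_eq0.
Qed.

(* Banach's theorem for finite families of symmetric forms. *)
Lemma symmetric_form_max (I : finType) (g : I -> vectors -> F) :
    (0 < n)%N -> (0 < d)%N -> (forall i, symmetric_form (g i)) ->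
  exists2 v, nsq v = 1 &
    forall x, unit_tuple x ->
      \sum_i sqmod (g i x) <= \sum_i sqmod (g i (fun=> v)).
Proof.
move=> n0 d0 sg; pose f x := \sum_i sqmod (g i x).
have cf : tcontinuous f.
  move=> X h hc; apply: continuous_rsum => i; apply: continuous_sqmod.
  exact: form_cont.
have unit0 : exists x : vectors, unit_tuple x.
  exists (fun=> delta_mx (Ordinal n0) 0) => j.
  rewrite /nsq (bigD1 (Ordinal n0)) //= big1 ?mxE ?eqxx /= ?sqmod1 ?addr0 //.
  by move=> i /negbTE ni; rewrite mxE ni /= sqmod0.
have fphase x w : (forall j, sqmod (w j) = 1) -> f (fun j => w j *: x j) = f x.
  by move=> w1; apply: eq_bigr => i _; apply: form_phase.
have [x xu xmax] := unit_tuple_lexmax unit0 cf coherence_cont.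
have parallel a b : a != b -> exists2 w : F, sqmod w = 1 & x b = w *: x a.
  move=> ab; have [//|] := unit_bisection (xu a) (xu b).
  move=> [w [r [s [m [k [w1 [r0 s0 rs] [m1 k1 mk] xa xb]]]]]]; exfalso.
  (* Only slot b needs its phase changed to bring the pair into bisected form; neither [f] nor
     [coherence] sees the change. *)
  pose w' j : F := if j == b then w else 1.
  have w'1 j : sqmod (w' j) = 1 by rewrite /w'; case: ifP; rewrite ?sqmod1.
  have wx : (fun j => w' j *: x j) =
      update2 x a b (sreal K r *: m + sreal K s *: k)
                    (sreal K r *: m - sreal K s *: k).
    rewrite -xa -xb -{1}(update2_id x a b); apply/funext => j.
    rewrite /w' /update2 /update; case: (j == b) => //.
    by case: (j == a); rewrite scale1r.
  have unit2 u : nsq u = 1 -> unit_tuple (update2 x a b u u).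
    by move=> u1 j; rewrite /update2 /update; case: ifP => // _; case: ifP.
  have s2 : s ^+ 2 = 1 - r ^+ 2 by rewrite -rs; ring.
  have r2 : 0 <= r ^+ 2 <= 1 by rewrite sqr_ge0 -subr_ge0 -s2 sqr_ge0.
  (* Polarisation gives r^2 g(m, m) - s^2 g(k, k); the sign is moved into the second value, where
     the modulus ignores it, and convexity applies. *)
  have fmix : f x <= r ^+ 2 * f (update2 x a b m m) +
                     s ^+ 2 * f (update2 x a b k k).
    rewrite -(fphase _ _ w'1) wx /f !mulr_sumr -big_split.
    apply: ler_sum => i _ /=; rewrite form_polar // s2 -mulrN.
    by rewrite -(sqmodN (g i (update2 x a b k k))); apply: sqmod_mix_le.
  have cmix : coherence x < r ^+ 2 * coherence (update2 x a b m m) +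
                            s ^+ 2 * coherence (update2 x a b k k).
    by rewrite -(coherence_phase _ w'1) wx; apply: coherence_mix.
  have [fm cm] := xmax _ (unit2 _ m1); have [fk ck] := xmax _ (unit2 _ k1).
  have r2gt : 0 < r ^+ 2 by rewrite exprn_gt0.
  have s2gt : 0 < s ^+ 2 by rewrite exprn_gt0.
  (* Both new tuples also maximise [f], so the tie-break bounds their coherence by that of x; the
     same argument on coherence then contradicts the strict inequality. *)
  have [/cm {}cm /ck {}ck] := mix_extreme r2gt s2gt rs fm fk fmix.
  have [cxm cxk] := mix_extreme r2gt s2gt rs cm ck (ltW cmix).
  by move: cmix; rewrite cxm cxk -mulrDl rs mul1r ltxx.
pose a := Ordinal d0; exists (x a) => // y /xmax [fy _].
suff -> : \sum_i sqmod (g i (fun=> x a)) = f x by [].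
(* Every entry is a phase times [x a], and phases leave [f] unchanged, so the constant tuple is a
   maximiser too. *)
have /choice [w wP] j : exists w : F, sqmod w = 1 /\ x j = w *: x a.
  have [->|ja] := eqVneq j a; first by exists 1; rewrite sqmod1 scale1r.
  by have [|w w1 xj] := parallel a j; [rewrite eq_sym | exists w].
have w1 j : sqmod (w j) = 1 by have [] := wP j.
rewrite -[LHS](fphase (fun=> x a) _ w1); congr f.
by apply/funext => j; have [] := wP j.
Qed.

End Symmetrization.

(** * Tensors and orthonormal frames of the plane *)

Section TensorForms.
Variables (R : realType) (K : field_kind) (n d : nat).
Local Notation F := (sfield R K).
Local Notation vectors := ('I_d -> 'cV[F]_n).
Implicit Types (T S Y : tensor R K n d) (x y : vectors).

Lemma tdotDl T T' S : tdot (T + T') S = tdot T S + tdot T' S.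
Proof. by rewrite /tdot -big_split; apply: eq_bigr => i _; rewrite ffunE mulrDl. Qed.

Lemma tdotZl (z : F) T S : tdot (z *: T) S = z * tdot T S.
Proof. by rewrite /tdot mulr_sumr; apply: eq_bigr => i _; rewrite ffunE mulrA. Qed.

Lemma tdotC T S : tdot T S = sconj (tdot S T).
Proof.
by rewrite /tdot sconj_sum; apply: eq_bigr => i _; rewrite sconjM sconjK mulrC.
Qed.

Lemma tdotDr T S S' : tdot T (S + S') = tdot T S + tdot T S'.
Proof. by rewrite tdotC tdotDl sconjD -!tdotC. Qed.

Lemma tdotZr (z : F) T S : tdot T (z *: S) = sconj z * tdot T S.
Proof. by rewrite tdotC tdotZl sconjM -tdotC. Qed.

Lemma tdotNr T S : tdot T (- S) = - tdot T S.
Proof. by rewrite -scaleN1r tdotZr sconjN sconj1 mulN1r. Qed.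

Lemma tdotNl T S : tdot (- T) S = - tdot T S.
Proof. by rewrite -scaleN1r tdotZl mulN1r. Qed.

Definition tsq T : R := \sum_i sqmod (T i : F).

Lemma tdot_tsq T : tdot T T = sreal K (tsq T).
Proof.
rewrite /tsq (big_morph _ (@srealD R K) (@sreal0 R K)).
by apply: eq_bigr => i _; rewrite sqmod_conjE.
Qed.

Lemma tsq_ge0 T : 0 <= tsq T.
Proof. by apply: sumr_ge0 => i _; apply: sqmod_ge0. Qed.

Lemma tnormE T : tnorm T = Num.sqrt (tsq T).
Proof. by rewrite /tnorm tdot_tsq sRe_real. Qed.

Lemma tsqB T S : tsq (T - S) = tsq T - 2 * sRe (tdot T S) + tsq S.
Proof.
rewrite -[LHS](sRe_real K) -tdot_tsq !(tdotDl, tdotDr, tdotNl, tdotNr) !tdot_tsq.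
by rewrite (tdotC S T) !sE; ring.
Qed.

Lemma tdot_tprod x y : tdot (tprod x) (tprod y) = \prod_j vdot (x j) (y j).
Proof.
rewrite /vdot bigA_distr_bigA; apply: eq_bigr => i _.
by rewrite !ffunE sconj_prod -big_split.
Qed.

Lemma tprodZ (z : 'I_d -> F) x :
  tprod (fun j => z j *: x j) = (\prod_j z j : F) *: tprod x.
Proof.
apply/ffunP => i; rewrite !ffunE -[RHS]big_split.
by apply: eq_bigr => j _; rewrite mxE.
Qed.

(** Intended for e the identity and for e = [perp], with c the identity or conjugation. The inner
    product is antilinear on the right, so the form is antilinear in the first case and linear in
    the second. *)
Lemma tensor_symmetric_form T (e : 'cV[F]_n -> 'cV[F]_n) (c : F -> F) :
    symmetric_tensor T -> {morph e : u v / u + v} ->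
    (forall z u, e (z *: u) = c z *: e u) ->
    (forall z, sqmod (c z) = sqmod z) ->
    (forall r, c (sreal K r) = sreal K r) ->
    (forall (X : topologicalType) (h : X -> 'cV[F]_n),
      (forall i, scontinuous (fun p => h p i 0)) ->
      forall i, scontinuous (fun p => e (h p) i 0)) ->
  symmetric_form (fun x => tdot T (tprod (fun j => e (x j)))).
Proof.
move=> sT eD eZ cN cR ec.
(* Isolating the factor of slot a makes additivity and real homogeneity in that slot visible
   termwise. *)
have updE x a u : tdot T (tprod (fun j => e (update x a u j))) =
    \sum_(i : {ffun 'I_d -> 'I_n}) (T i : F) * (sconj (e u (i a) 0) *
      sconj (\prod_(j | j != a) e (x j) (i j) 0)).
  apply: eq_bigr => i _; rewrite ffunE (bigD1 a) //= sconjM.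
  rewrite /update eqxx; congr (_ * (_ * sconj _)).
  by apply: eq_bigr => j /negbTE ->.
split.
- move=> s x; pose r (i : {ffun 'I_d -> 'I_n}) := [ffun j => i (s j)].
  (* Permuting the vectors is undone by permuting the tensor indices, which T does not notice. *)
  have r_inj : injective r.
    move=> i i' /ffunP ii'; apply/ffunP => j.
    by have := ii' (s^-1 j)%g; rewrite !ffunE permKV.
  rewrite /tdot (reindex_inj r_inj); apply: eq_bigr => i _ /=.
  rewrite sT; congr (_ * sconj _); rewrite !ffunE [RHS](reindex_inj (@perm_inj _ s)).
  by apply: eq_bigr => j _; rewrite ffunE.
- move=> x a u v; rewrite !updE -big_split; apply: eq_bigr => i _ /=.
  by rewrite eD mxE sconjD mulrDl mulrDr.
- move=> x a r u; rewrite !updE mulr_sumr; apply: eq_bigr => i _ /=.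
  by rewrite eZ mxE cR sconjM sconj_real !mulrA [_ * sreal K r]mulrC.
- move=> x w w1; rewrite (_ : (fun j => _) = (fun j => c (w j) *: e (x j))).
    rewrite tprodZ tdotZr sqmodM sqmod_conj sqmod_prod big1 ?mul1r // => j _.
    by rewrite cN.
  by apply/funext => j; rewrite eZ.
- move=> X h hc; apply: scontinuous_sum => i; apply: scontinuousM.
    exact: scontinuous_cst.
  apply: scontinuous_conj.
  under eq_fun do rewrite ffunE.
  by apply: scontinuous_prod => j; apply: ec.
Qed.

End TensorForms.

Section Plane.
Variables (R : realType) (K : field_kind) (d : nat).
Local Notation F := (sfield R K).
Local Notation vectors := ('I_d -> 'cV[F]_2).
Implicit Types (T Y : tensor R K 2 d) (x : vectors) (u v : 'cV[F]_2).

(** An everywhere defined, continuous choice of orthogonal vector: a quarter turn over the reals,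
    antilinear over the complex numbers. *)
Definition perp v : 'cV[F]_2 :=
  \col_i if i == 0 then - sconj (v 1 0) else sconj (v 0 0).

Lemma sum_I2 (V : nmodType) (f : 'I_2 -> V) : \sum_i f i = f 0 + f 1.
Proof.
by rewrite big_ord_recl big_ord1; congr (_ + f _); apply: val_inj.
Qed.

Lemma col2_ext u v : u 0 0 = v 0 0 -> u 1 0 = v 1 0 -> u = v.
Proof.
move=> h0 h1; apply/colP => i.
have [->|->] // : i = 0 \/ i = 1.
by case: i => [[|[|//]] ?]; [left|right]; apply: val_inj.
Qed.

Lemma perp0 v : perp v 0 0 = - sconj (v 1 0). Proof. by rewrite mxE. Qed.
Lemma perp1 v : perp v 1 0 = sconj (v 0 0). Proof. by rewrite mxE. Qed.

Lemma vdot_perp v : vdot v (perp v) = 0.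
Proof. by rewrite /vdot sum_I2 perp0 perp1 sconjN !sconjK; ring. Qed.

Lemma nsq_perp v : nsq (perp v) = nsq v.
Proof. by rewrite /nsq !sum_I2 perp0 perp1 sqmodN !sqmod_conj addrC. Qed.

Lemma perpK v : perp (perp v) = - v.
Proof.
by apply: col2_ext; rewrite !mxE /= ?sconjN sconjK.
Qed.

Lemma perpZ (z : F) v : perp (z *: v) = sconj z *: perp v.
Proof.
by apply: col2_ext; rewrite !mxE /= sconjM ?mulrN.
Qed.

Lemma orthogonal_perp u v : vdot u v = 0 -> nsq u = 1 ->
  v = sconj (vdot (perp u) v) *: perp u.
Proof.
move=> uv u1; rewrite -vdotC.
have e : u 0 0 * sconj (u 0 0) + u 1 0 * sconj (u 1 0) = 1.
  by move: (vdot_nsq u); rewrite u1 sreal1 /vdot sum_I2.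
have o : v 0 0 * sconj (u 0 0) + v 1 0 * sconj (u 1 0) = 0.
  by move: (vdotC v u); rewrite uv sconj0 /vdot sum_I2.
apply: col2_ext; rewrite mxE /vdot sum_I2 !perp0 !perp1 sconjN !sconjK.
  (* Replacing 1 by <u, u> and 0 by <v, u> leaves a polynomial identity; the other coordinate is
     treated alike. *)
  transitivity (v 0 0 * 1 - u 0 0 * 0); first by rewrite mulr1 mulr0 subr0.
  rewrite -{1}e -{1}o; ring.
transitivity (v 1 0 * 1 - u 1 0 * 0); first by rewrite mulr1 mulr0 subr0.
rewrite -{1}e -{1}o; ring.
Qed.

(** The terms in [CON] may contain zero vectors, so the frame is built from whichever vector is
    nonzero, and is arbitrary if both vanish. *)
Lemma orthogonal_pair u v : vdot u v = 0 ->
  exists (x : 'cV[F]_2) (a b : F), [/\ nsq x = 1, u = a *: x & v = b *: perp x].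
Proof.
have normalize (y : 'cV[F]_2) : y != 0 ->
    exists (x : 'cV[F]_2) (a : F), [/\ nsq x = 1, a != 0 & y = a *: x].
  move=> y0; have ny0 : nsq y != 0 by rewrite nsq_eq0.
  pose r := Num.sqrt (nsq y).
  have r2 : r ^+ 2 = nsq y by rewrite sqr_sqrtr ?nsq_ge0.
  have r0 : r != 0 by rewrite -sqrf_eq0 r2.
  exists (sreal K r^-1 *: y), (sreal K r); split.
  - by rewrite nsqZ sqmod_real exprVn r2 mulVf.
  - by rewrite -sqmod_eq0 sqmod_real r2.
  - by rewrite scalerA -srealM divff // sreal1 scale1r.
move=> uv; have [u0|/normalize[x [a [x1 a0 ux]]]] := eqVneq u 0; last first.
  exists x, a, (sconj (vdot (perp x) v)); split=> //.
  apply: orthogonal_perp => //; move: uv; rewrite ux vdotZl => /eqP.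
  by rewrite mulf_eq0 (negbTE a0) => /eqP.
have [v0|/normalize[y [b [y1 _ vy]]]] := eqVneq v 0; last first.
  (* The sign compensates perp (perp y) = - y. *)
  exists (perp y), 0, (- b); split; first by rewrite nsq_perp.
    by rewrite scale0r.
  by rewrite perpK scaleNr scalerN opprK.
exists (delta_mx 0 0), 0, 0; rewrite !scale0r; split=> //.
by rewrite /nsq sum_I2 !mxE /= sqmod1 sqmod0 addr0.
Qed.

End Plane.

(** * Frame energy and completely orthogonal approximation *)

Section Frames.
Variables (R : realType) (K : field_kind) (d : nat).
Local Notation F := (sfield R K).
Local Notation vectors := ('I_d -> 'cV[F]_2).
Implicit Types (T Y Z : tensor R K 2 d) (x : vectors) (u v w : 'cV[F]_2).

Definition frame_energy T x : R :=
  sqmod (tdot T (tprod x)) + sqmod (tdot T (tprod (fun j => perp (x j)))).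

Lemma frame_energy_max T : (0 < d)%N -> symmetric_tensor T ->
  exists2 v, nsq v = 1 & forall x, unit_tuple x ->
    frame_energy T x <= frame_energy T (fun=> v).
Proof.
move=> d0 sT.
(* The two summands of the energy become a family of forms indexed by [bool], maximised jointly. *)
pose e (b : bool) : 'cV[F]_2 -> 'cV[F]_2 := if b then id else @perp R K.
have sf b : symmetric_form (fun x => tdot T (tprod (fun j => e b (x j)))).
  case: b.
    by apply: (@tensor_symmetric_form _ _ _ _ T id id).
  apply: (@tensor_symmetric_form _ _ _ _ T (@perp R K) (@sconj R K)) => //.
  - by move=> u v; apply: col2_ext; rewrite !mxE /= sconjD ?opprD.
  - exact: perpZ.
  - exact: sqmod_conj.
  - exact: sconj_real.
  - move=> X h hc i.
    under eq_fun do rewrite mxE.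
    case: (i == 0); last exact: scontinuous_conj.
    by apply: scontinuousN; apply: scontinuous_conj.
have [v v1 vmax] := symmetric_form_max (isT : (0 < 2)%N) d0 sf.
by exists v => // x xu; have := vmax x xu; rewrite !big_bool.
Qed.

(** In each slot the two vectors lie along some x_j and [perp] x_j; multilinearity collects the
    scalars into s and t. *)
Lemma CON2_frame Y : CON 2 Y -> exists x (s t : F), unit_tuple x /\
  Y = s *: tprod x + t *: tprod (fun j => perp (x j)).
Proof.
move=> [sigma [v [orth ->]]]; rewrite sum_I2.
have /choice[z zP] j : exists z : 'cV[F]_2 * (F * F),
    [/\ nsq z.1 = 1, v 0 j = z.2.1 *: z.1 & v 1 j = z.2.2 *: perp z.1].
  by have [x [a [b ?]]] := orthogonal_pair (orth 0 1 isT j); exists (x, (a, b)).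
exists (fun j => (z j).1), (sigma 0 * \prod_j (z j).2.1),
  (sigma 1 * \prod_j (z j).2.2); split.
  by move=> j; have [] := zP j.
rewrite -!scalerA -!tprodZ; congr (_ *: tprod _ + _ *: tprod _);
  by apply/funext => j; have [] := zP j.
Qed.

Lemma CON2_tpow (s t : F) u v : (0 < d)%N -> vdot u v = 0 ->
  CON 2 (s *: tpow d u + t *: tpow d v).
Proof.
move=> d0 uv; exists (fun k => if k == 0 then s else t).
exists (fun k _ => if k == 0 then u else v); split; last by rewrite sum_I2.
have vu : vdot v u = 0 by rewrite vdotC uv sconj0.
by move=> [[|[|//]] ?] [[|[|//]] ?] kl j; rewrite ?eqxx // in kl *.
Qed.

(** Pythagoras: with d > 0, orthogonality in one slot already kills the inner product of the two
    products. *)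
Lemma tsq_orthogonal (s t : F) x y : (0 < d)%N -> unit_tuple x ->
    unit_tuple y -> (forall j, vdot (x j) (y j) = 0) ->
  tsq (s *: tprod x + t *: tprod y) = sqmod s + sqmod t.
Proof.
move=> d0 xu yu xy.
have unit z : unit_tuple z -> tdot (tprod z) (tprod z) = 1 :> F.
  by move=> zu; rewrite tdot_tprod big1 // => j _; rewrite vdot_nsq zu sreal1.
have orth : tdot (tprod x) (tprod y) = 0 :> F.
  by rewrite tdot_tprod (bigD1 (Ordinal d0)) //= xy mul0r.
rewrite -[LHS](sRe_real K) -tdot_tsq !(tdotDl, tdotDr, tdotZl, tdotZr) !unit //.
rewrite (tdotC (tprod y)) orth sconj0 !mulr0 !mulr1 addr0 add0r !sqmod_conjE.
by rewrite !sE.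
Qed.

(** Write Y in a frame and apply Cauchy-Schwarz to its two coefficients against those of T. *)
Lemma CON2_bound T Y (M : R) : (0 < d)%N ->
    (forall x, unit_tuple x -> frame_energy T x <= M) -> CON 2 Y ->
  sqmod (tdot T Y) <= M * tsq Y.
Proof.
move=> d0 hM /CON2_frame[x [s [t [xu ->]]]].
rewrite tsq_orthogonal //; first last.
- by move=> j; apply: vdot_perp.
- by move=> j; rewrite nsq_perp.
rewrite tdotDr !tdotZr (le_trans (sqmod_cauchy _ _ _ _)) // !sqmod_conj mulrC.
by rewrite ler_wpM2r ?hM // addr_ge0 ?sqmod_ge0.
Qed.

(** Arithmetic-geometric mean: 2|<T, Z>| is at most 2 sqrt(M |Z|^2), hence at most M + |Z|^2. *)
Lemma tsq_CON2_dist T Z (M : R) : 0 <= M -> sqmod (tdot T Z) <= M * tsq Z ->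
  tsq T - M <= tsq (T - Z).
Proof.
move=> M0 h; have Z0 := tsq_ge0 Z.
suff : 2 * sRe (tdot T Z) <= M + tsq Z by rewrite tsqB; lra.
apply: (@le_trans _ _ (2 * modulus (tdot T Z))).
  by rewrite ler_pM2l // sRe_le_modulus.
rewrite -(@ler_pXn2r _ 2) // ?nnegrE ?mulr_ge0 ?addr_ge0 ?modulus_ge0 //.
rewrite exprMn modulus_sqr -subr_ge0.
have : 0 <= (M - tsq Z) ^+ 2 by rewrite sqr_ge0.
nra.
Qed.

End Frames.

Theorem theorem4p8 (R : realType) (K : field_kind) (d : nat) (hd : (0 < d)%N)
    (T : tensor R K 2 d) (hT : symmetric_tensor T) :
  (exists (v w : 'cV[sfield R K]_2) (s1 s2 : sfield R K),
     vdot v w = 0 /\ vnorm v = 1 /\ vnorm w = 1 /\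
     best_approximation (CON 2) T (s1 *: tpow d v + s2 *: tpow d w)) /\
  (exists m : R,
     is_max [set x | exists Y : tensor R K 2 d,
               CON 2 Y /\ tnorm Y <= 1 /\ x = modulus (tdot T Y)] m /\
     is_max [set x | exists (v w : 'cV[sfield R K]_2) (s1 s2 : sfield R K),
               vdot v w = 0 /\ vnorm v = 1 /\ vnorm w = 1 /\
               modulus s1 ^+ 2 + modulus s2 ^+ 2 = 1 /\
               x = modulus (tdot T (s1 *: tpow d v + s2 *: tpow d w))] m).
Proof.
have [v v1 vmax] := frame_energy_max hd hT.
set M := frame_energy T (fun=> v) in vmax.
pose w := perp v; have w1 : nsq w = 1 by rewrite nsq_perp.
have vw : vdot v w = 0 by apply: vdot_perp.
have vn : vnorm v = 1 by apply/vnorm_eq1.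
have wn : vnorm w = 1 by apply/vnorm_eq1.
pose a := tdot T (tpow d v); pose b := tdot T (tpow d w).
have ME : M = sqmod a + sqmod b by [].
have M0 : 0 <= M by rewrite addr_ge0 ?sqmod_ge0.
have bound Y := CON2_bound hd vmax (Y := Y).
have tsq2 (p q : 'cV[sfield R K]_2) s t : vdot p q = 0 -> nsq p = 1 ->
    nsq q = 1 -> tsq (s *: tpow d p + t *: tpow d q) = sqmod s + sqmod t.
  by move=> *; apply: tsq_orthogonal.
have dotE (s t : sfield R K) : tdot T (s *: tpow d v + t *: tpow d w) =
    sconj s * a + sconj t * b.
  by rewrite tdotDr !tdotZr.
split.
  (* The coefficients a, b give the orthogonal projection of T onto the span of the two powers, at
     squared distance |T|^2 - M. *)
  exists v, w, a, b; do 3!split=> //; split; first exact: CON2_tpow.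
  move=> Z cZ; rewrite !tnormE ler_wsqrtr //.
  apply: le_trans (tsq_CON2_dist M0 (bound Z cZ)).
  rewrite tsqB dotE tsq2 // ![sconj _ * _]mulrC !sqmod_conjE !sE ME; lra.
have upper (Y : tensor R K 2 d) : CON 2 Y -> tnorm Y <= 1 ->
    modulus (tdot T Y) <= Num.sqrt M.
  move=> cY; rewrite tnormE -[1 in X in X -> _]sqrtr1 ler_sqrt ?ltr01 // => Y1.
  rewrite modulusE ler_wsqrtr // (le_trans (bound Y cY)) //.
  by rewrite -[leRHS]mulr1 ler_wpM2l.
(* Equality in Cauchy-Schwarz: (s, t) is (a, b) divided by sqrt M. If M = 0 then a and b vanish and
   any unit pair serves. *)
have [s [t [st stM]]] : exists s t : sfield R K,
    sqmod s + sqmod t = 1 /\ sqmod (sconj s * a + sconj t * b) = M.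
  have [M00|M00] := eqVneq M 0.
    exists 1, 0; rewrite sqmod1 sqmod0 addr0 sconj1 sconj0 mul1r mul0r addr0.
    split=> //; have := sqmod_ge0 a; have := sqmod_ge0 b.
    by move: ME; rewrite M00; lra.
  pose r := Num.sqrt M; have r2 : r ^+ 2 = M by rewrite sqr_sqrtr.
  have r0 : r != 0 by rewrite -sqrf_eq0 r2.
  exists (sreal K r^-1 * a), (sreal K r^-1 * b); split.
    by rewrite !sqmodM sqmod_real -mulrDr -ME exprVn r2 mulVf.
  rewrite !sconjM sconj_real -!mulrA -mulrDr ![sconj _ * _]mulrC !sqmod_conjE.
  by rewrite -srealD -ME sqmodM !sqmod_real -{2}r2 exprVn r2 expr2 mulKf.
exists (Num.sqrt M); split; split.
- exists (s *: tpow d v + t *: tpow d w); split; first exact: CON2_tpow.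
  by rewrite tnormE tsq2 // st sqrtr1 dotE modulusE stM.
- by move=> _ [Y [cY [Y1 ->]]]; apply: upper.
- exists v, w, s, t; do 3!split=> //.
  by rewrite !modulus_sqr st dotE modulusE stM.
(* A symmetric competitor is a unit element of [CON 2], so the general upper bound covers it. *)
- move=> _ [p [q [s' [t' [pq [/vnorm_eq1 p1 [/vnorm_eq1 q1 [st' ->]]]]]]]].
  apply: upper; first exact: CON2_tpow.
  by rewrite tnormE tsq2 // -!modulus_sqr st' sqrtr1.
Qed.
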